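(* Let $n\ge 1$ and let $K_0,K_1,\dots,K_n$ be strictly concave kernel functions such that either all of them satisfy condition $(\infty')$, or all of them belong to $\mathrm{C}^1(0,2\pi)$. For $\mathbf{y}=(y_1,\dots,y_n)\in\mathbb{T}^n$ let $F(\mathbf{y},t)=K_0(t)+\sum_{j=1}^nK_j(t-y_j)$. Then there is $\mathbf{w}^*=(w_1,\dots,w_n)\in\mathbb{T}^n$ with \[M:=\inf_{\mathbf{y}\in\mathbb{T}^n}\sup_{t\in\mathbb{T}}F(\mathbf{y},t)=\sup_{t\in\mathbb{T}}F(\mathbf{w}^*,t).\] Moreover: (a) $\mathbf{w}^*$ is an equioscillation point, i.e. $m_0(\mathbf{w}^* )=\dots=m_n(\mathbf{w}^* )$; (b) $\mathbf{w}^*\in S:=S_\sigma$ for some permutation $\sigma$ (so the nodes $0,w_1,\dots,w_n$ are pairwise different), and \[M(S)=\inf_{\mathbf{y}\in S}\max_{j=0,\dots,n}\sup_{t\in I_j(\mathbf{y})}F(\mathbf{y},t)=M=\sup_{\mathbf{y}\in S}\min_{j=0,\dots,n}\sup_{t\in I_j(\mathbf{y})}F(\mathbf{y},t)=m(S);\] (c) the Sandwich Property holds on $S$: for all $\mathbf{x},\mathbf{y}\in S$, $\underline{m}(\mathbf{x})\le M\le\overline{m}(\mathbf{y})$.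
   Context: Identify the torus $\mathbb{T}=\mathbb{R}/2\pi\mathbb{Z}$ with $[0,2\pi)$. A concave kernel function is a $2\pi$-periodic function $K:\mathbb{R}\to[-\infty,\infty)$ which is real-valued and concave on $(0,2\pi)$ and such that $\lim_{t\downarrow0}K(t)$ and $\lim_{t\uparrow2\pi}K(t)$ exist in $[-\infty,\infty)$ and are equal (their common value being $K(0)=K(2\pi)$); it is strictly concave if it is strictly concave on $(0,2\pi)$. $D_\pm$ denote one-sided derivatives. Condition $(\infty')$ for $K$: either $\lim_{t\uparrow2\pi}D_-K(t)=\lim_{t\uparrow2\pi}D_+K(t)=-\infty$, or $\lim_{t\downarrow0}D_-K(t)=\lim_{t\downarrow0}D_+K(t)=+\infty$. For a node system $\mathbf{y}\in\mathbb{T}^n$ put $y_0=0$, $y_{n+1}=2\pi$. For a permutation $\sigma$ of $\{1,\dots,n\}$ set $\sigma(0)=0,\sigma(n+1)=n+1$ and define the simplex $S_\sigma=\{\mathbf{y}\in\mathbb{T}^n:0<y_{\sigma(1)}<\dots<y_{\sigma(n)}<2\pi\}$; its closure consists of the $\mathbf{y}$ with $0\le y_{\sigma(1)}\le\dots\le y_{\sigma(n)}\le2\pi$. For $\mathbf{y}\in\overline{S_\sigma}$ and $k=0,\dots,n$, $I_{\sigma(k)}(\mathbf{y})=[y_{\sigma(k)},y_{\sigma(k+1)}]$ and $m_{\sigma(k)}(\mathbf{y})=\sup_{t\in I_{\sigma(k)}(\mathbf{y})}F(\mathbf{y},t)$ (the permutation being fixed). $\overline{m}(\mathbf{y})=\max_jm_j(\mathbf{y})=\sup_{t\in\mathbb{T}}F(\mathbf{y},t)$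 and $\underline{m}(\mathbf{y})=\min_jm_j(\mathbf{y})$. For $A\subseteq\mathbb{T}^n$, $M(A)=\inf_{\mathbf{y}\in A}\overline{m}(\mathbf{y})$ and $m(A)=\sup_{\mathbf{y}\in A}\underline{m}(\mathbf{y})$. A point $\mathbf{y}$ (of the closure of a fixed simplex) is an equioscillation point if $m_0(\mathbf{y})=\dots=m_n(\mathbf{y})$. *)

(* Defs.v *)
From HB Require Import structures.
From mathcomp Require Import all_boot all_order all_algebra perm.
From mathcomp Require Import all_classical all_reals all_analysis.
Set Implicit Arguments. Unset Strict Implicit. Unset Printing Implicit Defensive.
Import Order.TTheory GRing.Theory Num.Theory.
Import numFieldNormedType.Exports.
Local Open Scope classical_set_scope.
Local Open Scope ring_scope.

Section Kernels.
Variable R : realType.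

(* the torus T = R / 2piZ, identified with [0, 2pi) *)
Definition Tset : set R := [set t | 0 <= t < 2 * pi].

(* real part of a kernel (meaningful on (0,2pi), where K is finite) *)
Definition kreal (K : R -> \bar R) : R -> R := fun t => fine (K t).

Definition left_deriv (f : R -> R) (t d : R) : Prop :=
  (f (t + h) - f t) / h @[h --> 0^'-] --> d.
Definition right_deriv (f : R -> R) (t d : R) : Prop :=
  (f (t + h) - f t) / h @[h --> 0^'+] --> d.

Definition concave_kernel (K : R -> \bar R) : Prop :=
  (forall t, K (t + 2 * pi) = K t) /\
  (forall t, 0 < t < 2 * pi -> K t \is a fin_num) /\
  K 0 != +oo%E /\
  [/\
      (forall x y a, 0 < x < 2 * pi -> 0 < y < 2 * pi -> 0 <= a <= 1 ->
         a * kreal K x + (1 - a) * kreal K y <= kreal K (a * x + (1 - a) * y)),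
      K t @[t --> 0^'+] --> K 0 &
      K t @[t --> (2 * pi)^'-] --> K 0].

Definition strictly_concave_kernel (K : R -> \bar R) : Prop :=
  concave_kernel K /\
  (forall x y a, 0 < x < 2 * pi -> 0 < y < 2 * pi -> x != y -> 0 < a < 1 ->
     a * kreal K x + (1 - a) * kreal K y < kreal K (a * x + (1 - a) * y)).

Definition cond_inf' (K : R -> \bar R) : Prop :=
  exists Dm Dp : R -> R,
    (forall t, 0 < t < 2 * pi ->
       left_deriv (kreal K) t (Dm t) /\ right_deriv (kreal K) t (Dp t)) /\
    (((Dm t)%:E @[t --> (2 * pi)^'-] --> -oo%E /\
      (Dp t)%:E @[t --> (2 * pi)^'-] --> -oo%E) \/
     ((Dm t)%:E @[t --> 0^'+] --> +oo%E /\
      (Dp t)%:E @[t --> 0^'+] --> +oo%E)).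

Definition C1_0_2pi (K : R -> \bar R) : Prop :=
  (forall t, 0 < t < 2 * pi -> derivable (kreal K) t 1) /\
  {in `]0, 2 * pi[, continuous (derive1 (kreal K))}.

Variable n : nat.

Definition Fsum (K : 'I_n.+1 -> R -> \bar R) (y : 'I_n -> R) (t : R) : \bar R :=
  (K ord0 t + \sum_(j < n) K (lift ord0 j) (t - y j)%R)%E.

Definition supF K (y : 'I_n -> R) : \bar R :=
  ereal_sup [set Fsum K y t | t in Tset].

Definition torus_n : set ('I_n -> R) := [set y | forall i, Tset (y i)].

Definition Mval K : \bar R := ereal_inf [set supF K y | y in torus_n].

(* nodes in the order of the permutation s:
   node 0 = 0, node k = y_{s(k)} (1 <= k <= n), node (n+1) = 2pi *)
Definition node (s : {perm 'I_n}) (y : 'I_n -> R) (k : nat) : R :=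
  nth (2 * pi) (0 :: [seq y (s i) | i <- enum 'I_n]) k.

Definition simplex (s : {perm 'I_n}) : set ('I_n -> R) :=
  [set y | forall k : nat, (k <= n)%N -> node s y k < node s y k.+1].

(* m_{s(k)}(y) = sup over I_{s(k)}(y) = [node k, node (k+1)] of F(y, .) *)
Definition mk K s (y : 'I_n -> R) (k : 'I_n.+1) : \bar R :=
  ereal_sup [set Fsum K y t | t in [set t | node s y k <= t <= node s y k.+1]].

Definition mbar K s y : \bar R := (\big[maxe/-oo]_(k < n.+1) mk K s y k)%E.
Definition munder K s y : \bar R := (\big[mine/+oo]_(k < n.+1) mk K s y k)%E.

Definition MS K s : \bar R := ereal_inf [set mbar K s y | y in simplex s].
Definition mS K s : \bar R := ereal_sup [set munder K s y | y in simplex s].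

Definition equioscillation K s y : Prop := forall k l : 'I_n.+1, mk K s y k = mk K s y l.

End Kernels.

(* Main.v *)
Require Import Defs.
From HB Require Import structures.
From mathcomp Require Import all_boot all_order all_algebra perm.
From mathcomp Require Import all_classical all_reals all_analysis.
From mathcomp Require Import ring lra zify.
Set Implicit Arguments. Unset Strict Implicit. Unset Printing Implicit Defensive.
Import Order.TTheory GRing.Theory Num.Theory.
Import numFieldNormedType.Exports.
Local Open Scope classical_set_scope.
Local Open Scope ring_scope.

(** The exponential of [F(y, t)] is a finite product of continuous periodic
    functions of [t - y_j], so that [sup_t F(y, t)] is attained and, by
    compactness, has a minimizer [w].

    A node is never a global maximum point of [F(w, .)]: under (oo') one of the
    one-sided slopes at the node is infinite, and in the C^1 case the second
    difference of a strictly concave kernel at its node is at least [c h] while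
    that of the other kernels is [o(h)].

    On each of the [n + 1] arcs between consecutive nodes there is at most one
    global maximum point.  If one arc contains none, then there are at most [n]
    maximum points [z_k].  Choose supergradients [a_kj] of [K_j] at
    [z_k - w_j] with [sum_j a_kj = 0]; linear algebra in dimension [n] yields a
    direction [v <> 0] with [sum_j v_j a_kj >= 0] for all [k], and strict
    concavity makes [sup_t F(w + h v, t)] smaller than the minimum for small
    [h > 0].  Hence every arc of [w] contains a maximum point in its interior,
    which is equioscillation together with the distinctness of the nodes.

    On a simplex each [m_k] is concave, because [F] is jointly concave on
    [{(y, t) | t in I_k(y)}].  So if every [m_k(x)] exceeded the minimum, moving
    [w] slightly away from [x] would decrease all the [m_k]; this is the
    sandwich property. *)

(** * Concave functions and concave kernels *)

Section Concave.
Variable R : realType.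
Implicit Types (f g : R -> R) (A : set R) (x y z p : R).

Definition concave_on A f := forall x y p, A x -> A y -> 0 <= p <= 1 ->
  p * f x + (1 - p) * f y <= f (p * x + (1 - p) * y).

(** Concavity with weight [(z - y) / (z - x)] at [x], cleared of denominators so that linear
    arithmetic can use it. *)
Lemma concave_chord A f x y z : concave_on A f -> A x -> A z -> x < y < z ->
  (z - y) * f x + (y - x) * f z <= (z - x) * f y.
Proof.
move=> cf Ax Az /andP[xy yz].
have zx : 0 < z - x by lra.
have zx0 : z - x != 0 by rewrite gt_eqF.
have := cf x z ((z - y) / (z - x)) Ax Az.
have -> : (z - y) / (z - x) * x + (1 - (z - y) / (z - x)) * z = y by field.
have -> : 0 <= (z - y) / (z - x) <= 1.
  by rewrite divr_ge0 ?ler_pdivrMr//=; lra.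
move=> /(_ isT) /(ler_wpM2l (ltW zx)); apply: le_trans.
by rewrite le_eqVlt; apply/orP; left; apply/eqP; field.
Qed.

(** The chords joining [t] to [t - d] and to [t + d] bound [f] near [t] from above and below, whence
    a Lipschitz estimate at [t]. *)
Lemma concave_continuous f a b t : concave_on [set x | a < x < b] f ->
  a < t < b -> {for t, continuous f}.
Proof.
move=> cf /andP[at_ tb].
pose d := Num.min (t - a) (b - t) / 2.
have d0 : 0 < d by rewrite divr_gt0 // lt_min; lra.
have da : d < t - a by rewrite ltr_pdivrMr// gt_min; lra.
have db : d < b - t by rewrite ltr_pdivrMr// gt_min; lra.
clearbody d.
(* The summand 1 keeps [C] positive when both increments vanish; [e / C] is the final radius. *)
pose C := (`|f (t + d) - f t| + `|f t - f (t - d)|) / d + 1.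
have C0 : 0 < C by rewrite ltr_wpDl// divr_ge0// ?addr_ge0// ltW.
have Al : (fun x => a < x < b) (t - d) by apply/andP; split; lra.
have Ar : (fun x => a < x < b) (t + d) by apply/andP; split; lra.
have At : (fun x => a < x < b) t by apply/andP; split; lra.
have key x : `|x - t| < d -> `|f x - f t| <= C * `|x - t|.
  rewrite ltr_distl => /andP[x1 x2].
  have H1 := ler_norm (f (t + d) - f t).
  have H2 := ler_norm (f t - f (t - d)).
  have H3 := ler_norm (- (f (t + d) - f t)).
  have H4 := ler_norm (- (f t - f (t - d))).
  rewrite !normrN in H3 H4.
  have Ax : (fun x => a < x < b) x by apply/andP; split; lra.
  suff : d * `|f x - f t| <= (`|f (t + d) - f t| + `|f t - f (t - d)|) * `|x - t|.
    rewrite mulrC -ler_pdivlMr// => h; apply: le_trans h _.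
    by rewrite /C [leRHS]mulrDl mul1r [_ / d * _]mulrAC lerDl.
  have N1 := normr_ge0 (f (t + d) - f t).
  have N2 := normr_ge0 (f t - f (t - d)).
  rewrite -[X in X * _](gtr0_norm d0) -normrM.
  have [xt|xt|->] := ltgtP x t.
  - have Q1 := @concave_chord _ _ (t - d) x t cf Al At ltac:(lra).
    have Q2 := @concave_chord _ _ x t (t + d) cf Ax Ar ltac:(lra).
    rewrite (ltr0_norm (_ : x - t < 0)); last lra.
    by rewrite ler_norml; nra.
  - have Q1 := @concave_chord _ _ t x (t + d) cf At Ar ltac:(lra).
    have Q2 := @concave_chord _ _ (t - d) t x cf Al Ax ltac:(lra).
    rewrite (gtr0_norm (_ : 0 < x - t)); last lra.
    by rewrite ler_norml; nra.
  - by rewrite !subrr mulr0 !normr0 mulr0.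
apply/cvgrPdist_lt => e e0.
near=> x.
have xd : `|x - t| < d.
  by rewrite distrC; near: x; exact: (nbhsx_ballx t d d0).
rewrite distrC (le_lt_trans (key _ xd))// mulrC -ltr_pdivlMr// distrC.
near: x; exact: (nbhsx_ballx t (e / C) (divr_gt0 e0 C0)).
Unshelve. all: by end_near. Qed.

End Concave.

(** * Reduction modulo the period *)

Section Lattice.
Variable R : realType.
Implicit Types (t : R) (K : R -> \bar R).

(** These are the only points where a concave kernel may take the value [-oo]. *)
Definition on_lattice t := exists m : int, t = m%:~R * (2 * pi).

Lemma twopi_gt0 : 0 < 2 * pi :> R. Proof. by rewrite mulr_gt0// pi_gt0. Qed.

Lemma mod_twopi t : exists m : int, 0 <= t + m%:~R * (2 * pi) < 2 * pi.
Proof.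
exists (- Num.floor (t / (2 * pi))).
have p0 := twopi_gt0.
have /andP[] := floor_itv (t / (2 * pi)).
rewrite ler_pdivlMr// ltr_pdivrMr// rmorphD/= mulrDl mul1r rmorphN/= mulNr.
by move=> ? ?; apply/andP; split; lra.
Qed.

Lemma off_lattice_mod t : ~ on_lattice t ->
  exists m : int, 0 < t + m%:~R * (2 * pi) < 2 * pi.
Proof.
move=> nt; have [m /andP[m1 m2]] := mod_twopi t.
exists m; rewrite m2 andbT lt_neqAle m1 andbT; apply/eqP => e; apply: nt.
by exists (- m); rewrite rmorphN /= mulNr; lra.
Qed.

Lemma off_lattice_itv t (m : int) :
  0 < t + m%:~R * (2 * pi) < 2 * pi -> ~ on_lattice t.
Proof.
move=> h [k tE]; move: h.
rewrite tE -mulrDl -rmorphD/= pmulr_lgt0 ?twopi_gt0// -ltr_pdivlMr ?twopi_gt0//.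
by rewrite divff ?gt_eqF ?twopi_gt0// ltr0z -(@mulr1z R 1) ltr_int; lia.
Qed.

Lemma periodic_int K : (forall t, K (t + 2 * pi) = K t) ->
  forall t (m : int), K (t + m%:~R * (2 * pi)) = K t.
Proof.
move=> pK t m; have H (k : nat) s : K (s + k%:R * (2 * pi)) = K s.
  elim: k => [|k IH]; first by rewrite mul0r addr0.
  by rewrite -natr1 mulrDl mul1r addrA pK.
case: m => k; first exact: H.
rewrite -[LHS](H k.+1); congr K.
by rewrite NegzE rmorphN/= -pmulrn mulNr subrK.
Qed.

End Lattice.

(** * The exponential of a kernel, and concavity up to the nodes *)

Section ExpKernel.
Variable R : realType.
Implicit Types (t : R) (K : R -> \bar R).

(** For a concave kernel this turns the value [-oo] into 0, so that singular nodes become ordinary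
    zeros of a real continuous function. *)
Definition kexp K t : R := fine (expeR (K t)).

Lemma kexp_fin K t : K t \is a fin_num -> kexp K t = expR (kreal K t).
Proof. by rewrite /kexp /kreal; case: (K t). Qed.

Lemma kexp_ge0 K t : 0 <= kexp K t.
Proof. by apply: fine_ge0; exact: expeR_ge0. Qed.

Lemma fine_expeR_cvg (T : Type) (F : set_system T) (FF : ProperFilter F)
  (f : T -> \bar R) (l : \bar R) : l != +oo%E -> f @ F --> l ->
  fine (expeR (f x)) @[x --> F] --> fine (expeR l).
Proof.
case: l => [r _|//|_] fl.
- have /fine_cvgP[h1 h2] := fl.
  have : expR (fine (f x)) @[x --> F] --> expR r.
    by apply: continuous_cvg h2; exact: continuous_expR.
  apply: cvg_trans; apply: near_eq_cvg.
  by near=> x; have : f x \is a fin_num by [near: x]; case: (f x).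
- rewrite /=; apply/cvgrPdist_lt => e e0.
  have /cvgeNyPle/(_ (ln (e / 2))) h := fl.
  near=> x; have : (f x <= (ln (e / 2))%:E)%E by near: x; exact: h.
  have e2 : 0 < e / 2 by rewrite divr_gt0.
  case: (f x) => [s| |]//=; rewrite sub0r ?oppr0 ?normr0//.
  rewrite lee_fin normrN ger0_norm ?expR_ge0// -ler_expR lnK// => h3.
  by apply: le_lt_trans h3 _; lra.
Unshelve. all: by end_near. Qed.

Section OneKernel.
Variable K : R -> \bar R.
Hypothesis cK : concave_kernel K.

Let pK : forall t, K (t + 2 * pi) = K t. Proof. by case: cK. Qed.

Lemma kernel_fin t : ~ on_lattice t -> K t \is a fin_num.
Proof.
move=> /off_lattice_mod[m mP]; rewrite -(periodic_int pK t m).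
by case: cK => _ [+ _]; exact.
Qed.

Lemma kernel_npinfty t : K t != +oo%E.
Proof.
have [[m ->]|/kernel_fin] := pselect (on_lattice t); last by case: (K t).
by rewrite -[_ * _]add0r (periodic_int pK); case: cK => _ [_ []].
Qed.

Lemma kexp_gt0P t : 0 < kexp K t <-> K t \is a fin_num.
Proof.
split=> [|/kexp_fin ->]; last exact: expR_gt0.
by have := kernel_npinfty t; rewrite /kexp; case: (K t) => //=; rewrite ltxx.
Qed.

Lemma kexp_periodic t (m : int) : kexp K (t + m%:~R * (2 * pi)) = kexp K t.
Proof. by rewrite /kexp periodic_int. Qed.

Lemma kreal_periodic t (m : int) : kreal K (t + m%:~R * (2 * pi)) = kreal K t.
Proof. by rewrite /kreal periodic_int. Qed.

(** Off the lattice this is continuity of a concave function; at a lattice point the limits at [0]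
    from the right and at [2 * pi] from the left glue together by periodicity. *)
Lemma kexp_continuous : continuous (kexp K).
Proof.
have aux t (m : int) : {for t + m%:~R * (2 * pi), continuous (kexp K)} ->
    {for t, continuous (kexp K)}.
  move=> h; have c : x + m%:~R * (2 * pi) @[x --> t] --> t + m%:~R * (2 * pi).
    by apply: cvgD; [exact: cvg_id|exact: cvg_cst].
  have := cvg_comp _ _ c h; rewrite kexp_periodic.
  rewrite (_ : _ \o _ = kexp K)//.
  by apply/funext => x /=; rewrite kexp_periodic.
move=> t; have [[m ->]|/off_lattice_mod[m mP]] := pselect (on_lattice t).
  apply: (aux _ (- m)); rewrite rmorphN mulNr subrr.
  case: cK => _ [_ [K0 [_ Kr Kl]]].
  apply/left_right_continuousP; split; last exact: fine_expeR_cvg.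
  rewrite -(kexp_periodic 0 1) mul1r add0r.
  have -> : kexp K (2 * pi) = fine (expeR (K 0)).
    by rewrite /kexp -(pK 0) add0r.
  have KP : fine (expeR (K x)) @[x --> (2 * pi)^'-] --> fine (expeR (K 0)).
    exact: fine_expeR_cvg.
  apply/cvgrPdist_lt => e e0.
  have /cvgrPdist_lt/(_ e e0) := KP.
  move=> -[d /= d0 H]; exists d => //= x xd x0.
  have := H (x + 2 * pi); rewrite /ball/= in xd *.
  rewrite /kexp pK; apply; last by lra.
  by move: xd; rewrite sub0r; congr (`|_| < _); lra.
apply: (aux _ m); case: cK => _ [Kf [_ [Kc _ _]]].
have cL : {for t + m%:~R * (2 * pi), continuous (kreal K)}.
  by apply: (@concave_continuous _ _ 0 (2 * pi)) => // x y p; exact: Kc.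
rewrite /prop_for /continuous_at kexp_fin; last exact: Kf.
have : expR (kreal K x) @[x --> t + m%:~R * (2 * pi)] -->
    expR (kreal K (t + m%:~R * (2 * pi))).
  by apply: continuous_cvg cL; exact: continuous_expR.
apply: cvg_trans; apply: near_eq_cvg.
near=> x; rewrite kexp_fin//; apply: Kf.
have : x \in `]0, (2 * pi)[; last by rewrite in_itv.
by near: x; apply: near_in_itvoo; rewrite in_itv.
Unshelve. all: by end_near. Qed.

(** Taking the logarithm of [kexp] also covers a node at which the kernel is finite. *)
Lemma kreal_continuous t : K t \is a fin_num -> {for t, continuous (kreal K)}.
Proof.
move=> /[dup] Kt /kexp_gt0P et.
rewrite /prop_for /continuous_at.
have -> : kreal K t = ln (kexp K t) by rewrite kexp_fin// expRK.
have : ln (kexp K x) @[x --> t] --> ln (kexp K t).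
  by apply: continuous_cvg; [exact: continuous_ln|exact: kexp_continuous].
apply: cvg_trans; apply: near_eq_cvg.
near=> x; rewrite kexp_fin ?expRK//; apply/kexp_gt0P.
near: x; have := @cvgr_gt _ _ (nbhs t) _ (kexp K) (kexp K t).
by apply => //; exact: kexp_continuous.
Unshelve. all: by end_near. Qed.

Lemma kreal_concave_closed x y p : 0 <= x <= 2 * pi -> 0 <= y <= 2 * pi ->
  0 < p < 1 -> K x \is a fin_num -> K y \is a fin_num ->
  K (p * x + (1 - p) * y) \is a fin_num /\
  p * kreal K x + (1 - p) * kreal K y <= kreal K (p * x + (1 - p) * y).
Proof.
move=> xI yI pI Kx Ky.
have [<-|xy] := eqVneq x y.
  by rewrite -!mulrDl addrC subrK !mul1r.
have pp := @pi_gt0 R.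
have zI : 0 < p * x + (1 - p) * y < 2 * pi.
  have xy' := lt_total xy.
  apply/andP; split; case/orP: xy' => ?; nra.
have [Kz Kc] : K (p * x + (1 - p) * y) \is a fin_num /\ 
   concave_on [set x | 0 < x < 2 * pi] (kreal K).
  by case: cK => _ [Kf [_ [Kc _ _]]]; split; [exact: Kf|].
split => //.
(* contract the segment towards pi, so as to stay inside the open interval *)
pose s (z h : R) := z + h * (pi - z).
have sc z : K z \is a fin_num -> kreal K (s z h) @[h --> 0^'+] --> kreal K z.
  move=> Kf; apply: cvg_at_right_filter.
  have s0 : s z h @[h --> (0 : R)] --> z.
    rewrite -[X in _ --> X](_ : z + 0 * (pi - z) = z); last by rewrite mul0r addr0.
    by apply: cvgD; [exact: cvg_cst|apply: cvgM; [exact: cvg_id|exact: cvg_cst]].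
  exact: (cvg_comp _ _ s0 (kreal_continuous Kf)).
have L1 : p * kreal K (s x h) + (1 - p) * kreal K (s y h) @[h --> 0^'+] -->
    p * kreal K x + (1 - p) * kreal K y.
  by apply: cvgD; apply: cvgM; [exact: cvg_cst|exact: sc|exact: cvg_cst|exact: sc].
have L2 := sc _ Kz.
apply: (ler_cvg_to L1 L2).
near=> h.
have h0 : 0 < h by near: h; exact: nbhs_right_gt.
have h1 : h < 1 by near: h; exact: nbhs_right_lt.
have -> : s (p * x + (1 - p) * y) h = p * s x h + (1 - p) * s y h.
  by rewrite /s; ring.
by apply: Kc; rewrite /s /=; [apply/andP; split; nra|apply/andP; split; nra|lra].
Unshelve. all: by end_near. Qed.

End OneKernel.
End ExpKernel.

(** * Supergradients and slopes of kernels at their nodes *)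

Section Supergradient.
Variable R : realType.
Implicit Types (f g : R -> R) (d u v b : R).

Local Notation ival d := [set x : R | - d < x < d].

Lemma concave_on_opp f d : concave_on (ival d) f ->
  concave_on (ival d) (fun x => f (- x)).
Proof.
move=> cf x y p /= xd yd pI; rewrite opprD -!mulrN.
by apply: cf => //=; lra.
Qed.

Lemma concave_on_sum (A : set R) (m : nat) (f : 'I_m -> R -> R) :
  (forall j, concave_on A (f j)) -> concave_on A (fun x => \sum_j f j x).
Proof.
move=> cf x y p Ax Ay pI; rewrite !mulr_sumr -big_split /=.
by apply: ler_sum => j _; exact: cf.
Qed.

Let slope f u := (f u - f 0) / u.

Let slope_le f d u v : concave_on (ival d) f -> 0 < u <= v -> v < d ->
  slope f v <= slope f u.
Proof.
move=> cf /andP[u0]; rewrite le_eqVlt => /orP[/eqP->//|uv] vd.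
have := @concave_chord _ _ f 0 u v cf; rewrite /= => /(_ ltac:(lra) ltac:(lra)).
rewrite u0 uv => /(_ isT) H.
rewrite /slope ler_pdivrMr; last lra.
rewrite mulrAC ler_pdivlMr; last lra.
lra.
Qed.

(** The slope of [f (- x)] is minus the left slope of [f], so this compares right slopes with left
    ones. *)
Let slope_opp f d u : concave_on (ival d) f -> 0 < u < d ->
  slope f u + slope (fun x => f (- x)) u <= 0.
Proof.
move=> cf /andP[u0 ud]; rewrite /slope -mulrDl oppr0.
rewrite ler_pdivrMr// mul0r.
have := @concave_chord _ _ f (- u) 0 u cf; rewrite /= => /(_ ltac:(lra) ltac:(lra)).
move=> /(_ ltac:(lra)); nra.
Qed.

(* one-dimensional Hahn-Banach: the lower bounds on [a] given by the right
   slopes of [f] and the left slopes of [g] lie below the upper ones *)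
Lemma concave_sandwich f g d b : 0 < d ->
  concave_on (ival d) f -> concave_on (ival d) g ->
  (forall x, - d < x < d -> f x + g x <= f 0 + g 0 + b * x) ->
  exists a, forall x, - d < x < d ->
    f x <= f 0 + a * x /\ g x <= g 0 + (b - a) * x.
Proof.
move=> d0 cf cg fg.
pose f' x := f (- x); pose g' x := g (- x).
have cf' : concave_on (ival d) f' := concave_on_opp cf.
have cg' : concave_on (ival d) g' := concave_on_opp cg.
pose lo u := Num.max (slope f u) (b + slope g' u).
pose hi u := Num.min (- slope f' u) (b - slope g u).
have lohi u v : 0 < u < d -> 0 < v < d -> lo u <= hi v.
  move=> uI vI.
  (* Slopes are monotone, so all four comparisons between [lo u] and [hi v] reduce to the common
     step [w]. *)
  pose w := Num.min u v.
  have wI : 0 < w < d by rewrite /w; case: (ltP u v) => ?; lra.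
  have wu : 0 < w <= u by rewrite /w; case: (ltP u v) => ?; lra.
  have wv : 0 < w <= v by rewrite /w; case: (ltP u v) => ?; lra.
  have ud : u < d by lra.
  have vd : v < d by lra.
  have S1 := slope_le cf wu ud.
  have S2 := slope_le cg' wu ud.
  have S3 := slope_le cf' wv vd.
  have S4 := slope_le cg wv vd.
  have O1 := slope_opp cf wI.
  have O2 := slope_opp cg wI.
  rewrite -/f' in O1; rewrite -/g' in O2.
  (* The mixed bounds come from the hypothesis at [w] and at [- w]. *)
  have [B1 B2] : slope f w + slope g w <= b /\ - (slope f' w + slope g' w) >= b.
    rewrite /slope -!mulrDl /f' /g' oppr0; split.
      by rewrite ler_pdivrMr; have := fg w ltac:(lra); lra.
    rewrite -mulNr ler_pdivlMr; last lra.
    by have := fg (- w) ltac:(lra); lra.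
  by rewrite /lo /hi ge_max !le_min; apply/andP; split; apply/andP; split; lra.
pose S := [set lo u | u in [set u | 0 < u < d]].
have hI : 0 < d / 2 < d by apply/andP; split; lra.
have Sne : S !=set0 by exists (lo (d / 2)), (d / 2).
have Sub : has_ubound S.
  by exists (hi (d / 2)) => _ [u uI <-]; exact: lohi.
exists (sup S) => x xI.
have lo_le u : 0 < u < d -> lo u <= sup S.
  by move=> uI; apply: ub_le_sup => //; exists u.
have le_hi u : 0 < u < d -> sup S <= hi u.
  by move=> uI; apply: ge_sup => // _ [v vI <-]; exact: lohi.
have [x0|x0|->] := ltgtP x 0; last by rewrite !mulr0 !addr0.
  have uI : 0 < - x < d by lra.
  have := lo_le _ uI; have := le_hi _ uI.
  rewrite /lo /hi ge_max !le_min /slope /f' /g' opprK oppr0 => /andP[+ _] /andP[_].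
  rewrite -mulNr ler_pdivlMr; last lra.
  move=> H1; rewrite -lerBrDl ler_pdivrMr; last lra.
  by move=> H2; split; lra.
have uI : 0 < x < d by lra.
have := lo_le _ uI; have := le_hi _ uI.
rewrite /lo /hi ge_max !le_min /slope => /andP[_ +] /andP[+ _].
rewrite lerBrDl -lerBrDr ler_pdivrMr// => H1.
by rewrite ler_pdivrMr// => H2; split; lra.
Qed.

(** Induction on the number of summands: [concave_sandwich] splits the slope [b] between the first
    function and the sum of the others. *)
Lemma concave_sum_supergradient (m : nat) (f : 'I_m -> R -> R) d b : 0 < d ->
  (forall j, concave_on (ival d) (f j)) ->
  (forall x, - d < x < d -> \sum_j f j x <= \sum_j f j 0 + b * x) ->
  exists a : 'I_m -> R, \sum_j a j = b /\
    forall j x, - d < x < d -> f j x <= f j 0 + a j * x.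
Proof.
move=> d0; elim: m f b => [|m IH] f b cf H.
  exists (fun=> 0); split; last by case.
  (* With empty sums, the points [d / 2] and [- (d / 2)] force [b = 0]. *)
  have := H (d / 2); have := H (- (d / 2)); rewrite !big_ord0.
  by move=> /(_ ltac:(lra)) ? /(_ ltac:(lra)) ?; nra.
have [a aP] := @concave_sandwich (f ord0) (fun x => \sum_j f (lift ord0 j) x) d b
  d0 (cf ord0) (concave_on_sum (fun j => cf (lift ord0 j)))
  ltac:(by move=> x xI; have := H x xI; rewrite !big_ord_recl).
have [c [cs cP]] := IH (fun j => f (lift ord0 j)) (b - a)
  (fun j => cf (lift ord0 j)) (fun x xI => (aP x xI).2).
exists (fun j => oapp c a (unlift ord0 j)); split.
  rewrite big_ord_recl unlift_none /=.
  by under eq_bigr do rewrite liftK /=; rewrite cs; lra.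
move=> j x xI; case: (unliftP ord0 j) => [k ->|->] /=; first exact: cP.
exact: (aP x xI).1.
Qed.

End Supergradient.

(** * One-sided slopes and second differences of a single kernel *)

Section KernelSlopes.
Variables (R : realType) (K : R -> \bar R).
Hypothesis sK : strictly_concave_kernel K.

Let cK : concave_kernel K. Proof. by case: sK. Qed.

Lemma kreal_strict_shift (m : int) x y p :
  0 < x + m%:~R * (2 * pi) < 2 * pi -> 0 < y + m%:~R * (2 * pi) < 2 * pi ->
  x != y -> 0 < p < 1 ->
  p * kreal K x + (1 - p) * kreal K y < kreal K (p * x + (1 - p) * y).
Proof.
move=> xI yI xy pI; case: sK => _.
move=> /(_ (x + m%:~R * (2 * pi)) (y + m%:~R * (2 * pi)) p xI yI).
rewrite (inj_eq (addIr _)) xy => /(_ isT pI).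
rewrite !kreal_periodic// (_ : _ + _ * (y + _) =
  p * x + (1 - p) * y + m%:~R * (2 * pi)); last by ring.
by rewrite kreal_periodic.
Qed.

Lemma kreal_concave_shift (m : int) x y p :
  0 <= x + m%:~R * (2 * pi) <= 2 * pi -> 0 <= y + m%:~R * (2 * pi) <= 2 * pi ->
  0 < p < 1 -> K x \is a fin_num -> K y \is a fin_num ->
  K (p * x + (1 - p) * y) \is a fin_num /\
  p * kreal K x + (1 - p) * kreal K y <= kreal K (p * x + (1 - p) * y).
Proof.
have pK := cK.1.
move=> xI yI pI Kx Ky; have := kreal_concave_closed cK xI yI pI.
rewrite !(periodic_int pK) => /(_ Kx Ky).
rewrite !kreal_periodic// (_ : _ + _ * (y + _) =
  p * x + (1 - p) * y + m%:~R * (2 * pi)); last by ring.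
by rewrite kreal_periodic// (periodic_int pK).
Qed.

(** The sign [(-1) ^+ b] selects a side of [s]; one shift moves [s] and a neighbourhood on that side
    into a single closed period, where concavity applies. *)
Lemma mod_twopi_side (s : R) (b : bool) : exists (m : int) (d : R), 0 < d /\
  (forall h, 0 < h <= d -> 0 < s + (-1) ^+ b * h + m%:~R * (2 * pi) < 2 * pi) /\
  0 <= s + m%:~R * (2 * pi) <= 2 * pi.
Proof.
case: b.
  (* Reducing [- s] places the shifted [s] in the half-open interval from 0 excluded to [2 * pi]
     included, leaving room on its left. *)
  have [m mP] := mod_twopi (- s).
  exists (1 - m), ((2 * pi - (- s + m%:~R * (2 * pi))) / 2).
  have -> : (1 - m)%:~R * (2 * pi) = 2 * pi - m%:~R * (2 * pi) :> R.
    by rewrite intrD rmorphN/=; ring.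
  split; first by lra.
  by split=> [h|]; lra.
have [m mP] := mod_twopi s.
exists m, ((2 * pi - (s + m%:~R * (2 * pi))) / 2).
split; first by lra.
by split=> [h|]; rewrite ?expr0; lra.
Qed.

Lemma near_off_lattice (s : R) (b : bool) :
  \forall h \near 0^'+, ~ on_lattice (s + (-1) ^+ b * h).
Proof.
have [m [d [d0 [H _]]]] := mod_twopi_side s b.
near=> h; apply: (@off_lattice_itv _ _ m); apply: H.
by apply/andP; split; near: h; [exact: nbhs_right_gt|exact: nbhs_right_le].
Unshelve. all: by end_near. Qed.

(** The graph lies above the chord from [s] to [s + (-1) ^+ b * d], whose slope gives [C]; the
    one-sided slope itself may be infinite. *)
Lemma kreal_slope_lower (s : R) (b : bool) : K s \is a fin_num -> exists C,
  \forall h \near 0^'+, C * h <= kreal K (s + (-1) ^+ b * h) - kreal K s.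
Proof.
move=> Ks; have [m [d [d0 [H Hs]]]] := mod_twopi_side s b.
exists ((kreal K (s + (-1) ^+ b * d) - kreal K s) / d).
near=> h.
have hd : 0 < h < d.
  by apply/andP; split; near: h; [exact: nbhs_right_gt|exact: nbhs_right_lt].
have pI : 0 < 1 - h / d < 1.
  have : 0 < h / d < 1 by rewrite divr_gt0 ?ltr_pdivrMr//=; lra.
  by lra.
have dI := H d ltac:(lra).
have Kd := kernel_fin cK (off_lattice_itv dI).
have [_] := @kreal_concave_shift m s (s + (-1) ^+ b * d) _ Hs ltac:(lra) pI Ks Kd.
have -> : (1 - h / d) * s + (1 - (1 - h / d)) * (s + (-1) ^+ b * d) =
          s + (-1) ^+ b * h by field; rewrite gt_eqF.
move=> H1; rewrite lerBrDr; apply: le_trans H1.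
by rewrite le_eqVlt; apply/orP; left; apply/eqP; field; rewrite gt_eqF.
Unshelve. all: by end_near. Qed.

(** The point [pi] is the midpoint of [pi / 2] and [3 * pi / 2], where concavity already gives at
    least the average of the values at [0] and [pi]; strict concavity then compares the midpoint. *)
Lemma kreal0_lt_pi : K 0 \is a fin_num -> kreal K 0 < kreal K pi.
Proof.
move=> K0; have pp := @pi_gt0 R.
have Kp : K pi \is a fin_num by apply: cK.2.1; lra.
have K2p : K (2 * pi) \is a fin_num by rewrite -[2 * pi]add0r cK.1.
have [_ H1] := @kreal_concave_closed _ _ cK (0) (pi) 2^-1
    ltac:(lra) ltac:(lra) ltac:(lra) K0 Kp.
have [_ H2] := @kreal_concave_closed _ _ cK (2 * pi) (pi) 2^-1
    ltac:(lra) ltac:(lra) ltac:(lra) K2p Kp.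
have L2 : kreal K (2 * pi) = kreal K 0 by rewrite /kreal -{1}[2 * pi]add0r cK.1.
case: sK => _ /(_ (2^-1 * 0 + (1 - 2^-1) * pi)
  (2^-1 * (2 * pi) + (1 - 2^-1) * pi) (2^-1)).
have -> : 2^-1 * (2^-1 * 0 + (1 - 2^-1) * pi) + (1 - 2^-1) *
  (2^-1 * (2 * pi) + (1 - 2^-1) * pi) = pi :> R by field.
move=> /(_ ltac:(lra) ltac:(lra) ltac:(rewrite lt_eqF//; lra) ltac:(lra)).
by rewrite L2 in H2; lra.
Qed.

(** Seen from the node, the chords towards [pi] from [0] and from [2 * pi] both rise, with slope
    [(kreal K pi - kreal K 0) / pi]. *)
Lemma kreal_second_difference_node (s : R) : on_lattice s ->
  K s \is a fin_num -> exists2 c, 0 < c & \forall h \near 0^'+,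
  c * h <= (kreal K (s + h) - kreal K s) + (kreal K (s - h) - kreal K s).
Proof.
move=> [m ->]; have pK := cK.1.
rewrite -[m%:~R * _]add0r (periodic_int pK) => K0.
have pp := @pi_gt0 R.
have lt0 := kreal0_lt_pi K0.
have Kp : K pi \is a fin_num by apply: cK.2.1; lra.
have K2p : K (2 * pi) \is a fin_num by rewrite -[2 * pi]add0r pK.
have L2 : kreal K (2 * pi) = kreal K 0 by rewrite /kreal -{1}[2 * pi]add0r pK.
exists (2 * (kreal K pi - kreal K 0) / pi).
  by rewrite divr_gt0 // mulr_gt0//; lra.
near=> h.
have hd : 0 < h < pi.
  by apply/andP; split; near: h; [exact: nbhs_right_gt|exact: nbhs_right_lt].
have pI : 0 < 1 - h / pi < 1.
  have : 0 < h / pi < 1 by rewrite divr_gt0 ?ltr_pdivrMr//=; lra.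
  by lra.
rewrite [_ + h]addrAC [_ - h]addrAC !kreal_periodic// !add0r.
have <- : kreal K (2 * pi - h) = kreal K (- h).
  by rewrite /kreal addrC pK.
have [_ H1] := @kreal_concave_closed _ _ cK (0) (pi) _
    ltac:(lra) ltac:(lra) pI K0 Kp.
have [_ H2] := @kreal_concave_closed _ _ cK (2 * pi) (pi) _
    ltac:(lra) ltac:(lra) pI K2p Kp.
have p0 : pi != 0 :> R by rewrite gt_eqF.
rewrite (_ : (1 - h / pi) * 0 + _ = h) in H1; last first.
  by move: (@pi R) p0 => q q0; field.
rewrite (_ : (1 - h / pi) * (2 * pi) + _ = 2 * pi - h) in H2; last first.
  by move: (@pi R) p0 => q q0; field.
rewrite L2 in H2; rewrite -[_ / pi * h]mulrA [_ * h]mulrC.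
by set q := h / pi in pI H1 H2 *; lra.
Unshelve. all: by end_near. Qed.

(** The derivative contributes opposite terms at [s + h] and [s - h]; each remainder is at most
    [e / 2 * h]. *)
Lemma kreal_second_difference_diff (s : R) : ~ on_lattice s -> C1_0_2pi K ->
  forall e, 0 < e -> \forall h \near 0^'+,
  - e * h <= (kreal K (s + h) - kreal K s) + (kreal K (s - h) - kreal K s).
Proof.
move=> ns [dK _] e e0.
have [m mI] := off_lattice_mod ns.
set s' := s + _ in mI.
have [D sh] : exists D : R, (kreal K (h + s') - kreal K s') / h @[h --> 0^'] --> D.
  have /cvg_ex[D HD] := dK _ mI; exists D.
  apply: cvg_trans HD; apply: near_eq_cvg; near=> h.
  by rewrite /= /GRing.scale /= mulr1 mulrC.
have e2 : 0 < e / 2 by lra.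
have /cvgrPdist_lt/(_ _ e2)[r /= r0 H] := sh.
near=> h.
have h0 : 0 < h by near: h; exact: nbhs_right_gt.
have hr : h < r by near: h; exact: nbhs_right_lt.
have A x : kreal K (s + x) = kreal K (x + s').
  by rewrite /s' addrA kreal_periodic// addrC.
rewrite !A -{1 2}(kreal_periodic cK s m) -/s'.
have := H h; rewrite /ball/= sub0r normrN gtr0_norm// => /(_ hr).
rewrite gt_eqF// => /(_ isT); rewrite ltr_distlC => /andP[+ _].
rewrite ltr_pdivlMr// => H1.
have := H (- h); rewrite /ball/= sub0r opprK gtr0_norm// => /(_ hr).
rewrite oppr_eq0 gt_eqF// => /(_ isT); rewrite ltr_distlC => /andP[_].
rewrite invrN mulrN -mulNr ltr_pdivrMr// => H2.
by lra.
Unshelve. all: by end_near. Qed.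

(** By concavity the chord from a nearby point to the node is at least as steep as the one-sided
    derivative at that point; [b] records on which side the derivatives blow up. *)
Lemma kreal_slope_node_infty (s : R) : on_lattice s -> cond_inf' K ->
  K s \is a fin_num -> exists b : bool, forall C, \forall h \near 0^'+,
  C * h <= kreal K (s + (-1) ^+ b * h) - kreal K s.
Proof.
move=> [m ->] [Dm [Dp [D [[DmN _]|[_ DpP]]]]]; have pK := cK.1.
all: rewrite -[m%:~R * _]add0r (periodic_int pK) => K0.
all: have pp := @pi_gt0 R.
all: have K2p : K (2 * pi) \is a fin_num by rewrite -[2 * pi]add0r pK.
all: have L2 : kreal K (2 * pi) = kreal K 0 by rewrite /kreal -{1}[2 * pi]add0r pK.
- exists true => C.
  have /cvgeNyPle/(_ (- C))[r /= r0 Hr] := DmN.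
  near=> h.
  have h0 : 0 < h by near: h; exact: nbhs_right_gt.
  have hr : h < r by near: h; exact: nbhs_right_lt.
  have hp : h < 2 * pi by near: h; apply: nbhs_right_lt; lra.
  have DC : Dm (2 * pi - h) <= - C.
    rewrite -lee_fin; apply: Hr; last by lra.
    by rewrite /ball/= opprB addrCA subrr addr0 gtr0_norm.
  rewrite expr1 mulN1r addrAC !kreal_periodic// add0r.
  have <- : kreal K (2 * pi - h) = kreal K (- h) by rewrite /kreal addrC pK.
  have [DL _] := D (2 * pi - h) ltac:(lra).
  suff : (kreal K 0 - kreal K (2 * pi - h)) / h <= Dm (2 * pi - h).
    by rewrite ler_pdivrMr//; nra.
  apply: (ler_cvg_to (cvg_cst _) DL); near=> k.
  have k0 : k < 0 by near: k; exact: nbhs_left_lt.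
  have kp : h - 2 * pi < k by near: k; apply: nbhs_left_gt; lra.
  rewrite ler_ndivlMr// mulrAC ler_pdivlMr//.
  have kh : 0 < h - k by lra.
  have pI : 0 < h / (h - k) < 1 by rewrite divr_gt0 ?ltr_pdivrMr//=; lra.
  have KI : K (2 * pi - h + k) \is a fin_num by apply: cK.2.1; lra.
  have [_] := @kreal_concave_closed _ _ cK (2 * pi - h + k) (2 * pi) _
    ltac:(lra) ltac:(lra) pI KI K2p.
  rewrite (_ : h / (h - k) * _ + (1 - h / (h - k)) * (2 * pi) = 2 * pi - h);
    last by field; rewrite gt_eqF.
  move=> /(ler_wpM2l (ltW kh)).
  rewrite mulrDr mulrA mulrCA divff ?gt_eqF// mulr1 mulrA mulrBr mulr1 mulrCA
    divff ?gt_eqF// mulr1 L2; lra.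
- exists false => C.
  have /cvgeyPge/(_ C)[r /= r0 Hr] := DpP.
  near=> h.
  have h0 : 0 < h by near: h; exact: nbhs_right_gt.
  have hr : h < r by near: h; exact: nbhs_right_lt.
  have hp : h < 2 * pi by near: h; apply: nbhs_right_lt; lra.
  have DC : C <= Dp h.
    rewrite -lee_fin; apply: Hr; last by lra.
    by rewrite /ball/= sub0r normrN gtr0_norm.
  rewrite expr0 mul1r addrAC !kreal_periodic// add0r.
  have [_ DL] := D h ltac:(lra).
  suff : Dp h <= (kreal K h - kreal K 0) / h.
    by rewrite ler_pdivlMr//; nra.
  apply: (ler_cvg_to DL (cvg_cst _)); near=> k.
  have k0 : 0 < k by near: k; exact: nbhs_right_gt.
  have kp : k < 2 * pi - h by near: k; apply: nbhs_right_lt; lra.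
  rewrite ler_pdivrMr// mulrAC ler_pdivlMr//.
  have kh : 0 < h + k by lra.
  have pI : 0 < h / (h + k) < 1 by rewrite divr_gt0 ?ltr_pdivrMr//=; lra.
  have KI : K (h + k) \is a fin_num by apply: cK.2.1; lra.
  have [_] := @kreal_concave_closed _ _ cK (h + k) (0) _
    ltac:(lra) ltac:(lra) pI KI K0.
  rewrite (_ : h / (h + k) * _ + (1 - h / (h + k)) * 0 = h);
    last by field; rewrite gt_eqF.
  move=> /(ler_wpM2l (ltW kh)).
  rewrite mulrDr mulrA mulrCA divff ?gt_eqF// mulr1 mulrA mulrBr mulr1 mulrCA
    divff ?gt_eqF// mulr1; lra.
Unshelve. all: by end_near. Qed.

End KernelSlopes.

(** * Sums of translates and their minimizer *)

Section SumOfTranslates.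
Variables (R : realType) (n : nat) (K : 'I_n.+1 -> R -> \bar R).
Hypothesis sK : forall j, strictly_concave_kernel (K j).
Implicit Types (Y : 'I_n.+1 -> R) (y : 'I_n -> R) (t : R).

Let cK j : concave_kernel (K j). Proof. by case: (sK j). Qed.

(** All [n.+1] nodes are free here, so that every kernel is treated alike; the problem itself is
    recovered through [pinned]. *)
Definition translate_sum Y t : \bar R := (\sum_j K j (t - Y j)%R)%E.
Definition translate_prod Y t : R := \prod_j kexp (K j) (t - Y j).

(* the node of the kernel [K ord0] is pinned at [0] *)
Definition pinned y (j : 'I_n.+1) : R := oapp y 0 (unlift ord0 j).

Lemma pinned0 y : pinned y ord0 = 0.
Proof. by rewrite /pinned unlift_none. Qed.

Lemma pinned_lift y i : pinned y (lift ord0 i) = y i.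
Proof. by rewrite /pinned liftK. Qed.

Lemma Fsum_pinned y t : Fsum K y t = translate_sum (pinned y) t.
Proof.
rewrite /Fsum /translate_sum big_ord_recl pinned0 subr0; congr (_ + _)%E.
by apply: eq_bigr => j _; rewrite pinned_lift.
Qed.

Lemma expeR_translate_sum Y t :
  expeR (translate_sum Y t) = (translate_prod Y t)%:E.
Proof.
rewrite /translate_sum /translate_prod.
elim/big_rec2 : _ => [|j a b _ IH]; first by rewrite expeR0.
rewrite expeRD IH EFinM; congr (_ * _)%E.
have := kernel_npinfty (cK j) (t - Y j).
by rewrite /kexp; case: (K j _).
Qed.

Lemma translate_sum_le Y Y' t t' : (translate_sum Y t <= translate_sum Y' t')%E =
  (translate_prod Y t <= translate_prod Y' t').
Proof. by rewrite -lee_expeR !expeR_translate_sum lee_fin. Qed.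

Lemma translate_sum_lt Y Y' t t' : (translate_sum Y t < translate_sum Y' t')%E =
  (translate_prod Y t < translate_prod Y' t').
Proof. by rewrite -lte_expeR !expeR_translate_sum lte_fin. Qed.

Lemma translate_sum_fin Y t : (forall j, K j (t - Y j) \is a fin_num) ->
  translate_sum Y t = (\sum_j kreal (K j) (t - Y j))%:E.
Proof.
move=> H; rewrite -sumEFin; apply: eq_bigr => j _.
by rewrite /kreal fineK.
Qed.

Lemma translate_sum_finP Y t : (-oo < translate_sum Y t)%E ->
  forall j, K j (t - Y j) \is a fin_num.
Proof.
move=> /expeR_gt0; rewrite expeR_translate_sum lte_fin => /lt0r_neq0.
rewrite /translate_prod => /prodf_neq0 H j.
by apply/(kexp_gt0P (cK j)); rewrite lt_neqAle kexp_ge0 eq_sym H.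
Qed.

Lemma translate_sum_periodic Y t (m : int) :
  translate_sum Y (t + m%:~R * (2 * pi)) = translate_sum Y t.
Proof.
apply: eq_bigr => j _; rewrite addrAC.
by rewrite periodic_int//; case: (cK j).
Qed.

Lemma translate_sum_node_periodic Y Y' t :
  (forall j, on_lattice (Y' j - Y j)) ->
  translate_sum Y t = translate_sum Y' t.
Proof.
move=> H; apply: eq_bigr => j _; have [m mP] := H j.
rewrite -(periodic_int (cK j).1 (t - Y' j) m); congr (K j _).
by rewrite -mP; lra.
Qed.

(** A general filter allows the point, the nodes, or both to vary. *)
Lemma translate_prod_cvg (T : Type) (F : set_system T) (FF : Filter F)
    (Yf : T -> 'I_n.+1 -> R) (tf : T -> R) Y t :
  (forall j, tf x - Yf x j @[x --> F] --> t - Y j) ->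
  translate_prod (Yf x) (tf x) @[x --> F] --> translate_prod Y t.
Proof.
move=> H; rewrite /translate_prod.
apply: cvg_big => [|j _]; first exact: mul_continuous.
by apply: continuous_cvg (H j); exact: (kexp_continuous (cK j)).
Qed.

Lemma translate_sum_max Y : exists2 t0, Tset t0 &
  forall t, (translate_sum Y t <= translate_sum Y t0)%E.
Proof.
have p0 := @twopi_gt0 R.
have [] := @EVT_max R (translate_prod Y) 0 (2 * pi) (ltW p0).
  apply: continuous_subspaceT => t; apply: translate_prod_cvg => j.
  by apply: cvgB; [exact: cvg_id|exact: cvg_cst].
move=> c _ cP; have [m mP] := mod_twopi c.
exists (c + m%:~R * (2 * pi)) => // t.
rewrite translate_sum_periodic.
have [k /andP[k1 k2]] := mod_twopi t.
rewrite -(translate_sum_periodic Y t k) translate_sum_le; apply: cP.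
by rewrite in_itv /= k1 ltW.
Qed.

(** Small [h > 0] avoid all the finitely many nodes modulo the period, so the sum is finite
    there. *)
Lemma translate_sum_max_gtNy Y t0 :
  (forall t, (translate_sum Y t <= translate_sum Y t0)%E) ->
  (-oo < translate_sum Y t0)%E.
Proof.
move=> H; near (0 : R)^'+ => h.
apply: lt_le_trans (H h).
rewrite translate_sum_fin ?ltNyr// => j; apply: (kernel_fin (cK j)).
have -> : h - Y j = - Y j + (-1) ^+ false * h by rewrite expr0 mul1r addrC.
by move: j; near: h; apply: filter_forall => j; exact: near_off_lattice.
Unshelve. all: by end_near. Qed.

Lemma translate_sum_diff_le0 Y t0 t :
  (forall t, (translate_sum Y t <= translate_sum Y t0)%E) ->
  (forall j, K j (t - Y j) \is a fin_num) ->
  \sum_j (kreal (K j) (t - Y j) - kreal (K j) (t0 - Y j)) <= 0.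
Proof.
move=> H Kt; have K0 := translate_sum_finP (translate_sum_max_gtNy H).
have := H t; rewrite !translate_sum_fin// lee_fin.
by rewrite sumrB subr_le0.
Qed.

Lemma node_not_max Y t0 j0 :
  ((forall j, cond_inf' (K j)) \/ (forall j, C1_0_2pi (K j))) ->
  (forall t, (translate_sum Y t <= translate_sum Y t0)%E) ->
  ~ on_lattice (t0 - Y j0).
Proof.
move=> hyp H l0.
have K0 := translate_sum_finP (translate_sum_max_gtNy H).
have Hb (b : bool) : \forall h \near 0^'+,
    \sum_j (kreal (K j) (t0 - Y j + (-1) ^+ b * h) - kreal (K j) (t0 - Y j)) <= 0.
  near=> h.
  under eq_bigr do rewrite addrAC; apply: translate_sum_diff_le0 => // j.
  apply: (kernel_fin (cK j)); rewrite addrAC; move: j.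
  by near: h; apply: filter_forall => j; exact: near_off_lattice.
case: hyp => [hinf|hC1].
  have [b bP] := kreal_slope_node_infty (sK j0) l0 (hinf j0) (K0 j0).
  have /choice[C CP] : forall j, exists C, \forall h \near 0^'+,
      C * h <= kreal (K j) (t0 - Y j + (-1) ^+ b * h) - kreal (K j) (t0 - Y j).
    by move=> j; exact: (kreal_slope_lower (sK j) b (K0 j)).
  near (0 : R)^'+ => h.
  have h0 : 0 < h by near: h; exact: nbhs_right_gt.
  have : \sum_j (kreal (K j) (t0 - Y j + (-1) ^+ b * h) -
      kreal (K j) (t0 - Y j)) <= 0 by near: h; exact: Hb.
  rewrite (bigD1 j0) //= leNgt => /negP; apply.
  (* The infinite slope of [K j0] is made to exceed by 1 whatever the other kernels can lose. *)
  have B1 : (1 - \sum_(j | j != j0) C j) * h <=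
    kreal (K j0) (t0 - Y j0 + (-1) ^+ b * h) - kreal (K j0) (t0 - Y j0).
    by near: h; exact: bP.
  have B2 : (\sum_(j | j != j0) C j) * h <= \sum_(j | j != j0)
     (kreal (K j) (t0 - Y j + (-1) ^+ b * h) - kreal (K j) (t0 - Y j)).
    rewrite mulr_suml; apply: ler_sum => j _; move: j.
    by near: h; apply: filter_forall => j; exact: CP.
  by apply: lt_le_trans (lerD B1 B2); lra.
have [c c0 cP] := kreal_second_difference_node (sK j0) l0 (K0 j0).
(* Chosen so that the other kernels together cost at most [c / 2 * h], half the gain [c * h] of
   [K j0]. *)
pose e := c / (2 * n.+1%:R).
have n0 : 0 < n.+1%:R :> R by rewrite ltr0n.
have e0 : 0 < e by rewrite divr_gt0// mulr_gt0.
have P j : \forall h \near 0^'+, - e * h <=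
   (kreal (K j) (t0 - Y j + h) - kreal (K j) (t0 - Y j)) +
   (kreal (K j) (t0 - Y j - h) - kreal (K j) (t0 - Y j)).
  (* Nodes may coincide: another kernel with its node at [t0] has a nonnegative second
     difference. *)
  have [l|nl] := pselect (on_lattice (t0 - Y j)); last first.
    exact: kreal_second_difference_diff.
  have [d d0 dP] := kreal_second_difference_node (sK j) l (K0 j).
  near=> h; have h0 : 0 < h by near: h; exact: nbhs_right_gt.
  by apply: (@le_trans _ _ (d * h)); [nra|near: h].
near (0 : R)^'+ => h.
have h0 : 0 < h by near: h; exact: nbhs_right_gt.
have B1 : \sum_j (kreal (K j) (t0 - Y j + (-1) ^+ false * h) -
    kreal (K j) (t0 - Y j)) <= 0 by near: h; exact: Hb.
have B2 : \sum_j (kreal (K j) (t0 - Y j + (-1) ^+ true * h) -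
    kreal (K j) (t0 - Y j)) <= 0 by near: h; exact: Hb.
have B3 : c * h <= (kreal (K j0) (t0 - Y j0 + h) - kreal (K j0) (t0 - Y j0)) +
   (kreal (K j0) (t0 - Y j0 - h) - kreal (K j0) (t0 - Y j0)) by near: h.
have B4 j : - e * h <= (kreal (K j) (t0 - Y j + h) - kreal (K j) (t0 - Y j)) +
   (kreal (K j) (t0 - Y j - h) - kreal (K j) (t0 - Y j)).
  by move: j; near: h; exact: filter_forall.
have := lerD B1 B2; rewrite -big_split /= addr0 expr0 expr1.
under eq_bigr do rewrite mul1r mulN1r.
rewrite (bigD1 j0)//= leNgt => /negP; apply.
have B5 : - (c / 2) * h <= \sum_(j | j != j0)
  ((kreal (K j) (t0 - Y j + h) - kreal (K j) (t0 - Y j)) +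
   (kreal (K j) (t0 - Y j - h) - kreal (K j) (t0 - Y j))).
  apply: (@le_trans _ _ (\sum_(j < n.+1 | j != j0) (- e * h))); last first.
    by apply: ler_sum => j _; exact: B4.
  rewrite sumr_const; set k := #|_|.
  have kn : k%:R <= n.+1%:R :> R.
    by rewrite ler_nat (leq_trans (max_card _))// card_ord.
  have -> : - (c / 2) * h = - e * h * n.+1%:R.
    by rewrite /e; move: n.+1%:R n0 => N N0; field; rewrite gt_eqF.
  by rewrite -[leRHS]mulr_natr ler_wnM2l// mulNr oppr_le0 mulr_ge0// ltW.
by apply: lt_le_trans (lerD B3 B5); nra.
Unshelve. all: by end_near. Qed.

Lemma minimizer_exists : exists2 w : 'I_n -> R, torus_n w &
  forall y, exists t', forall t,
    (translate_sum (pinned w) t <= translate_sum (pinned y) t')%E.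
Proof.
have p0 := @twopi_gt0 R.
pose of_row (v : 'rV[R]_n) := pinned (fun i => v ord0 i).
pose box := [set v : 'rV[R]_n | forall i, `[0, 2 * pi]%classic (v ord0 i)].
have cbox : compact box.
  apply: (@rV_compact R n (fun=> `[0, 2 * pi]%classic)) => i.
  exact: segment_compact.
(* The upper bounds of the products over all node systems in the box; [inf C] is the exponential of
   the minimal value. *)
pose C := [set c : R | exists2 v, box v & forall t, translate_prod (of_row v) t <= c].
have C0 v : box v -> exists2 t0, C (translate_prod (of_row v) t0) &
    (forall t, (translate_sum (of_row v) t <= translate_sum (of_row v) t0)%E).
  move=> bv; have [t0 _ tP] := translate_sum_max (of_row v); exists t0 => //.
  by exists v => // t; rewrite -translate_sum_le.
have b0 : box (\row_i 0) by move=> i; rewrite mxE /= in_itv /= lexx ltW.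
have Clb : lbound C 0.
  move=> c [v _ /(_ 0)]; apply: le_trans.
  by apply: prodr_ge0 => j _; exact: kexp_ge0.
have Cne : C !=set0 by have [t0 Ct0 _] := C0 _ b0; eexists; exact: Ct0.
have Ci : has_inf C by split => //; exists 0.
have [v bv vP] : exists2 v, box v & forall t, translate_prod (of_row v) t <= inf C.
  apply: contrapT => nv.
  (* If no system in the box attains [inf C], each exceeds it somewhere; compactness makes the
     excess uniform. *)
  have [r /= r0 rP] : \forall c \near (inf C)^'+,
      box `<=` (fun v => exists t, c < translate_prod (of_row v) t).
    move/compact_near_coveringP : (cbox); apply => v bv.
    have [t tP] : exists t, inf C < translate_prod (of_row v) t.
      apply: contrapT => nt; apply: nv; exists v => // t.
      by rewrite leNgt; apply/negP => ?; apply: nt; exists t.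
    have cv : translate_prod (of_row v') t @[v' --> v] --> translate_prod (of_row v) t.
      apply: (@translate_prod_cvg _ (nbhs v) _ of_row (fun=> t)) => j.
      apply: cvgB; first exact: cvg_cst.
      rewrite /of_row /pinned; case: (unlift ord0 j) => [i|] /=; last exact: cvg_cst.
      exact: coord_continuous.
    pose q := (inf C + translate_prod (of_row v) t) / 2.
    exists ([set v' | q < translate_prod (of_row v') t], [set c | c < q]) => /=.
      split; last by apply: nbhs_right_lt; rewrite /q; lra.
      by apply: (cvgr_gt _ cv); rewrite /q; lra.
    by move=> [v' c] [/= ? ?]; exists t; lra.
  have [c [v bv cP] cr] := @inf_adherent _ C r r0 Ci.
  have ic : inf C <= c by apply: ge_inf; [exists 0|exists v].
  (* Strictly between [c] and [inf C + r]: the bound [c] of [v] contradicts the uniform excess at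
     level [c']. *)
  pose c' := (c + (inf C + r)) / 2.
  have := rP c'; rewrite /ball/= ltr0_norm; last by rewrite /c'; lra.
  move=> /(_ ltac:(rewrite /c'; lra) ltac:(rewrite /c'; lra) v bv)[t].
  by have := cP t; rewrite /c'; lra.
have /choice[m mP] : forall i, exists m : int, 0 <= v ord0 i + m%:~R * (2 * pi) < 2 * pi.
  by move=> i; exact: mod_twopi.
exists (fun i => v ord0 i + (m i)%:~R * (2 * pi)); first by move=> i; exact: mP.
move=> y.
have /choice[k kP] : forall i, exists k : int, 0 <= y i + k%:~R * (2 * pi) < 2 * pi.
  by move=> i; exact: mod_twopi.
have [|t' Ct' _] := C0 (\row_i (y i + (k i)%:~R * (2 * pi))).
  by move=> i /=; rewrite mxE in_itv/=; have /andP[-> /ltW ->] := kP i.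
exists t' => t.
have pl (x : 'I_n -> R) (l : 'I_n -> int) s : translate_sum (pinned x) s =
    translate_sum (pinned (fun i => x i + (l i)%:~R * (2 * pi))) s.
  apply: translate_sum_node_periodic => j; rewrite /pinned.
  case: (unlift ord0 j) => [i|] /=; last by exists 0; rewrite mul0r subrr.
  by exists (l i); rewrite addrAC subrr add0r.
rewrite -pl (pl y k) translate_sum_le (le_trans (vP t))//.
rewrite (le_trans (ge_inf _ Ct')) //; first by exists 0.
rewrite le_eqVlt; apply/orP; left; apply/eqP; congr (translate_prod (pinned _) _).
by apply/funext => i; rewrite mxE.
Qed.

End SumOfTranslates.

(** * Perturbation of the minimizer *)

(** An invertible matrix has a preimage of the all-ones row; a singular one has a nonzero kernel
    vector. *)
Lemma square_mx_nonneg_image (R : realType) (n : nat) (A : 'M[R]_n) : (0 < n)%N ->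
  exists2 v : 'rV[R]_n, v != 0 & forall k, 0 <= (v *m A) ord0 k.
Proof.
move=> n0; have [uA|nA] := boolP (A \in unitmx).
  have E : (const_mx 1 *m invmx A) *m A = const_mx 1 :> 'rV[R]_n.
    by rewrite -mulmxA mulVmx// mulmx1.
  exists (const_mx 1 *m invmx A); last by move=> k; rewrite E mxE.
  apply: contraTneq isT => v0; move: E; rewrite v0 mul0mx => /rowP/(_ (Ordinal n0)).
  by rewrite !mxE => /eqP; rewrite eq_sym oner_eq0.
have : kermx A != 0 by rewrite kermx_eq0 row_free_unit.
move=> /rowV0Pn[v /sub_kermxP vA v0]; exists v => // k.
by rewrite vA mxE.
Qed.

Section Perturbation.
Variables (R : realType) (n : nat) (K : 'I_n.+1 -> R -> \bar R).
Hypothesis sK : forall j, strictly_concave_kernel (K j).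
Implicit Types (Y : 'I_n.+1 -> R) (y : 'I_n -> R) (t : R).

Let cK j : concave_kernel (K j). Proof. by case: (sK j). Qed.

Definition is_max Y z := forall t, (translate_sum K Y t <= translate_sum K Y z)%E.

Definition strict_supergradient Y z (a : 'I_n.+1 -> R) :=
  \sum_j a j = 0 /\ exists2 d, 0 < d & forall j x, - d < x < d ->
    [/\ K j (z - Y j + x) \is a fin_num,
        kreal (K j) (z - Y j + x) <= kreal (K j) (z - Y j) + a j * x &
        x != 0 -> kreal (K j) (z - Y j + x) < kreal (K j) (z - Y j) + a j * x].

(** At a maximum point the sum has supergradient 0, which [concave_sum_supergradient] distributes
    over the kernels. *)
Lemma max_supergradient Y z : is_max Y z ->
  (forall j, ~ on_lattice (z - Y j)) -> exists a, strict_supergradient Y z a.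
Proof.
move=> zmax nz.
have /choice[m mP] : forall j, exists m : int,
    0 < z - Y j + m%:~R * (2 * pi) < 2 * pi.
  by move=> j; exact: off_lattice_mod.
have [d [d0 dP]] : exists d, 0 < d /\ forall j x, - d < x < d ->
    0 < z - Y j + x + (m j)%:~R * (2 * pi) < 2 * pi.
  near (0 : R)^'+ => d; exists d; split; first by near: d; exact: nbhs_right_gt.
  move=> j x xd.
  have d1 i : d < z - Y i + (m i)%:~R * (2 * pi).
    move: i; near: d; apply: filter_forall => i; apply: nbhs_right_lt.
    by case/andP: (mP i).
  have d2 i : d < 2 * pi - (z - Y i + (m i)%:~R * (2 * pi)).
    move: i; near: d; apply: filter_forall => i; apply: nbhs_right_lt.
    by have := mP i; lra.
  by have := d1 j; have := d2 j; lra.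
have fin j x : - d < x < d -> K j (z - Y j + x) \is a fin_num.
  by move=> /(dP j) /off_lattice_itv; exact: kernel_fin.
have [||a [a0 aP]] := @concave_sum_supergradient _ _
    (fun j x => kreal (K j) (z - Y j + x)) d 0 d0.
- move=> j x y p /= xI yI pI.
  case: (cK j) => _ [_ [_ [Kc _ _]]].
  have := Kc _ _ p (dP j _ xI) (dP j _ yI) pI.
  rewrite !kreal_periodic//.
  have -> : p * (z - Y j + x + (m j)%:~R * (2 * pi)) +
      (1 - p) * (z - Y j + y + (m j)%:~R * (2 * pi)) =
      z - Y j + (p * x + (1 - p) * y) + (m j)%:~R * (2 * pi) by ring.
  by rewrite kreal_periodic.
- move=> x xI; rewrite mul0r addr0.
  have := @translate_sum_diff_le0 _ _ _ sK Y z (z + x) zmax.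
  rewrite sumrB subr_le0 => H.
  under eq_bigr do rewrite addrAC.
  under [leRHS]eq_bigr do rewrite addr0.
  by apply: H => j; rewrite addrAC; exact: fin.
exists a; split => //; exists d => // j x xI.
have le := aP j x xI; rewrite addr0 in le.
split => //; first exact: fin.
move=> x0.
(* Strictness: the bound at [x / 2] combined with strict concavity between 0 and [x]. *)
have mI : - d < x / 2 < d by lra.
have := aP j _ mI; rewrite addr0.
have := @kreal_strict_shift _ _ (sK j) (m j) (z - Y j + x) (z - Y j) 2^-1
  (dP j _ xI) (mP j).
rewrite -subr_eq0 addrAC subrr add0r => /(_ x0 ltac:(lra)).
have -> : 2^-1 * (z - Y j + x) + (1 - 2^-1) * (z - Y j) = z - Y j + x / 2 by field.
by lra.
Unshelve. all: by end_near. Qed.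

(* First order in [h] the perturbation does not raise the value at [z]; strict
   concavity of the kernels turns this into a strict decrease. *)
Lemma supergradient_decrease w z a (v : 'I_n -> R) :
  strict_supergradient (pinned w) z a -> (exists i, v i != 0) ->
  0 <= \sum_i v i * a (lift ord0 i) ->
  \forall t \near z & h \near 0^'+,
    (translate_sum K (pinned (fun i => w i + h * v i)%R) t <
     translate_sum K (pinned w) z)%E.
Proof.
move=> [a0 [d d0 dP]] [i0 vi0] va.
pose V := pinned v.
have VE h j : pinned (fun i => w i + h * v i) j = pinned w j + h * V j.
  by rewrite /V /pinned; case: (unlift ord0 j) => [i|] //=; rewrite mulr0 addr0.
have nd : 0 < d / 2 by lra.
exists ([set t | `|z - t| < d / 2], [set h | 0 < h /\ forall j, `|h * V j| < d / 2]).
  split => /=; first exact: nbhsx_ballx.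
  near=> h; split; first by near: h; exact: nbhs_right_gt.
  near: h; apply: filter_forall => j.
  have hV : h * V j @[h --> (0 : R)^'+] --> 0.
    apply: cvg_at_right_filter; rewrite -[X in _ --> X](mul0r (V j)).
    by apply: cvgM; [exact: cvg_id|exact: cvg_cst].
  have /cvgrPdist_lt/(_ _ nd) := hV.
  by apply: filterS => h; rewrite sub0r normrN.
move=> [t h] [/= tz [h0 hV]].
(* The displacement of the argument of [K j] when [z] moves to [t] and the nodes move by
   [h * V j]. *)
pose x j := t - z - h * V j.
have xd j : - d < x j < d.
  have := hV j; move: tz; rewrite /x !ltr_norml => /andP[? ?] /andP[? ?].
  by apply/andP; split; lra.
have E j : t - pinned (fun i => w i + h * v i) j = z - pinned w j + x j.
  by rewrite VE /x; lra.
have fz j : K j (z - pinned w j) \is a fin_num.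
  by have [] := dP j 0 ltac:(lra); rewrite addr0.
rewrite !translate_sum_fin => [|j|j]; last 2 first.
- exact: fz.
- by rewrite E; have [] := dP j _ (xd j).
rewrite lte_fin; under eq_bigr do rewrite E.
apply: (@lt_le_trans _ _
  (\sum_j (kreal (K j) (z - pinned w j) + a j * x j))); last first.
  rewrite big_split /= gerDl.
  have -> : \sum_j a j * x j = (t - z) * \sum_j a j - h * \sum_j a j * V j.
    rewrite !mulr_sumr -sumrB; apply: eq_bigr => j _; rewrite /x; ring.
  rewrite a0 mulr0 sub0r oppr_le0 mulr_ge0 ?(ltW h0)//.
  rewrite big_ord_recl /V pinned0 mulr0 add0r.
  by under eq_bigr do rewrite pinned_lift mulrC.
(* If [t] differs from [z], the pinned kernel is displaced; otherwise a node with [v i0 != 0] is. *)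
have [j1 xj1] : exists j, x j != 0.
  have [tz0|tz0] := eqVneq (t - z) 0; last first.
    by exists ord0; rewrite /x /V pinned0 mulr0 subr0.
  exists (lift ord0 i0); rewrite /x /V pinned_lift tz0 sub0r oppr_eq0.
  by rewrite mulf_neq0// gt_eqF.
rewrite (bigD1 j1) //= [ltRHS](bigD1 j1) //=; apply: ltr_leD.
  by have [_ _] := dP j1 _ (xd j1); exact.
by apply: ler_sum => j _; have [] := dP j _ (xd j).
Unshelve. all: by end_near. Qed.

(** There are as many arcs as movable nodes, so the supergradients form a square matrix and one
    direction [v] serves every maximum point. *)
Lemma few_max_not_minimal w z0 (arc : 'I_n -> set R) : (0 < n)%N ->
  is_max (pinned w) z0 ->
  (forall z j, is_max (pinned w) z -> ~ on_lattice (z - pinned w j)) ->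
  (forall z, 0 <= z <= 2 * pi -> is_max (pinned w) z -> exists k, arc k z) ->
  (forall k z z', arc k z -> arc k z' -> is_max (pinned w) z ->
     is_max (pinned w) z' -> z = z') ->
  exists y, forall t,
    (translate_sum K (pinned y) t < translate_sum K (pinned w) z0)%E.
Proof.
move=> n0 z0max nolat cover uniq.
have /choice[a aP] : forall k, exists a, forall z, arc k z -> is_max (pinned w) z ->
    strict_supergradient (pinned w) z a.
  move=> k; have [[z [zk zm]]|nz] := pselect (exists z, arc k z /\ is_max (pinned w) z).
    have [a aP] := max_supergradient zm (fun j => nolat z j zm).
    by exists a => z' z'k z'm; rewrite (uniq _ _ _ z'k zk z'm zm).
  by exists (fun=> 0) => z zk zm; exfalso; apply: nz; exists z.
have [v v0 vP] := square_mx_nonneg_image (\matrix_(i, k) a k (lift ord0 i)) n0.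
have vne : exists i, v ord0 i != 0.
  apply: contrapT => nv; move/eqP: v0; apply; apply/rowP => i; rewrite mxE.
  by apply/eqP; apply: contrapT => /negP vi; apply: nv; exists i.
have va k : 0 <= \sum_i v ord0 i * a k (lift ord0 i).
  by have := vP k; rewrite mxE; under eq_bigr do rewrite mxE.
pose y h i := w i + h * v ord0 i.
(* Compactness gives one [h] for all [t]: near maximum points by [supergradient_decrease], elsewhere
   by continuity. *)
have NC : \forall h \near (0 : R)^'+, `[0, 2 * pi]%classic `<=`
    (fun t => (translate_sum K (pinned (y h)) t < translate_sum K (pinned w) z0)%E).
  move/compact_near_coveringP : (@segment_compact R 0 (2 * pi)); apply => t.
  rewrite /= in_itv /= => tI.
  have [tm|ntm] := pselect (is_max (pinned w) t).
    have [k tk] := cover _ tI tm.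
    have -> : translate_sum K (pinned w) z0 = translate_sum K (pinned w) t.
      by apply/eqP; rewrite eq_le tm z0max.
    exact: (supergradient_decrease (aP k t tk tm) vne (va k)).
  have lt0 : (translate_sum K (pinned w) t < translate_sum K (pinned w) z0)%E.
    rewrite ltNge; apply/negP => le0; apply: ntm => s.
    exact: le_trans (z0max s) le0.
  rewrite translate_sum_lt// in lt0.
  have cv : translate_prod K (pinned (y p.2)) p.1 @[p --> (t, 0^'+)] -->
      translate_prod K (pinned w) t.
    apply: (translate_prod_cvg sK) => j.
    apply: cvgB; first exact: cvg_fst.
    rewrite /pinned; case: (unlift ord0 j) => [i|] /=; last exact: cvg_cst.
    rewrite -[X in _ --> X]addr0 -[X in _ + X](mul0r (v ord0 i)) /y.
    apply: cvgD; first exact: cvg_cst.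
    apply: cvgM; last exact: cvg_cst.
    apply: cvg_trans; first exact: cvg_snd.
    exact: cvg_within.
  have [[A B] [/= tA hB] AB] := @cvgr_lt _ _ _ _ _ _ cv _ lt0.
  exists (A, B) => // -[s h] /= ABsh; rewrite translate_sum_lt//.
  exact: (AB (s, h)).
near (0 : R)^'+ => h.
have hP : `[0, 2 * pi]%classic `<=`
    (fun t => (translate_sum K (pinned (y h)) t < translate_sum K (pinned w) z0)%E).
  by near: h.
exists (y h) => t; have [t0 /andP[t1 t2] t0P] := translate_sum_max sK (pinned (y h)).
by apply: le_lt_trans (t0P t) _; apply: hP; rewrite /= in_itv/= t1 ltW.
Unshelve. all: by end_near. Qed.

End Perturbation.

(** * Simplices *)

Section Nodes.
Variables (R : realType) (n : nat) (s : {perm 'I_n}).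
Implicit Types (y : 'I_n -> R) (t : R).

Lemma node_ordS y (i : 'I_n) : node s y i.+1 = y (s i).
Proof.
by rewrite /node /= (nth_map i) ?nth_ord_enum// size_enum_ord.
Qed.

Lemma node_last y : node s y n.+1 = 2 * pi.
Proof. by rewrite /node /= nth_default// size_map size_enum_ord. Qed.

Lemma node_affine p (x y u : 'I_n -> R) k : (k <= n.+1)%N ->
  (forall i, u i = p * x i + (1 - p) * y i) ->
  node s u k = p * node s x k + (1 - p) * node s y k.
Proof.
move=> kn uE; case: k kn => [|k]; first by rewrite /node /= !mulr0 addr0.
rewrite ltnS leq_eqVlt => /orP[/eqP->|kn]; first by rewrite !node_last; ring.
by have := uE (s (Ordinal kn)); rewrite -!(node_ordS _ (Ordinal kn)).
Qed.

(** The index of the node of kernel [j] in the ordered list; the pinned kernel has index 0. *)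
Definition position (j : 'I_n.+1) : nat :=
  oapp (fun i => (s^-1%g i : nat).+1) 0%N (unlift ord0 j).

Lemma position_le j : (position j <= n)%N.
Proof. by rewrite /position; case: unlift => //= i. Qed.

Lemma pinned_position y j : pinned y j = node s y (position j).
Proof.
rewrite /pinned /position; case: unlift => //= i.
by rewrite node_ordS permKV.
Qed.

Definition closed_simplex : set ('I_n -> R) :=
  [set y | forall k, (k <= n)%N -> node s y k <= node s y k.+1].

Lemma simplexW y : simplex s y -> closed_simplex y.
Proof. by move=> ys k kn; exact/ltW/ys. Qed.

Lemma node_le y k l : closed_simplex y -> (k <= l <= n.+1)%N ->
  node s y k <= node s y l.
Proof.
move=> ys /andP[kl]; rewrite -(subnKC kl).
elim: (l - k)%N => [|d IH] h; first by rewrite addn0.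
rewrite addnS in h *; apply: le_trans (IH (ltnW h)) _.
by apply: ys; rewrite -ltnS.
Qed.

Lemma node_range y k : closed_simplex y -> (k <= n.+1)%N ->
  0 <= node s y k <= 2 * pi.
Proof.
move=> ys kn; apply/andP; split; first by apply: (@node_le y 0 k).
by rewrite -(node_last y); apply: node_le => //; rewrite kn leqnn.
Qed.

Definition arc y (k : nat) : set R :=
  [set t | node s y k <= t <= node s y k.+1].

Lemma arc_cover y t : 0 <= t <= 2 * pi -> exists k : 'I_n.+1, arc y k t.
Proof.
move=> /andP[t0 t1].
have H m : (m <= n)%N -> node s y m <= t \/ exists k : 'I_n.+1, arc y k t.
  elim: m => [|m IH] mn; first by left.
  have [mt|?] := IH (ltnW mn); last by right.
  have [|/ltW tm] := leP (node s y m.+1) t; first by left.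
  right; exists (Ordinal (leqW mn)) => /=.
  by rewrite /arc/= mt.
have [nt|//] := H n (leqnn _).
by exists ord_max; rewrite /arc /= nt node_last.
Qed.

(** Nodes to the right of arc [k] need one period added. The shift is the same for all points of the
    arc, so kernels stay concave along it. *)
Definition arc_shift (k : nat) (j : 'I_n.+1) : int :=
  if (position j <= k)%N then 0 else 1.

Lemma arc_range y (k : nat) t j : closed_simplex y -> (k <= n)%N -> arc y k t ->
  0 <= t - pinned y j + (arc_shift k j)%:~R * (2 * pi) <= 2 * pi.
Proof.
move=> ys kn /andP[t1 t2]; rewrite /arc_shift pinned_position.
have r1 := node_range ys (leqW (position_le j)).
have r2 := node_range ys (leqW kn).
have r3 := node_range ys (kn : (k.+1 <= n.+1)%N).
case: leqP => pk.
  have := @node_le y (position j) k ys; rewrite pk leqW// => /(_ isT).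
  by rewrite mul0r addr0; lra.
have := @node_le y k.+1 (position j) ys; rewrite pk leqW ?position_le// => /(_ isT).
by rewrite mul1r; lra.
Qed.

End Nodes.

Lemma sorting_perm (R : realType) (n : nat) (y : 'I_n -> R) : torus_n y ->
  exists s : {perm 'I_n}, closed_simplex s y.
Proof.
move=> yT.
pose le_y : rel 'I_n := fun i j => y i <= y j.
pose r := sort le_y (enum 'I_n).
have sr : size r = n by rewrite size_sort size_enum_ord.
have ur : uniq r by rewrite sort_uniq enum_uniq.
(* As [r] has length [n], the default [i] is never returned. *)
pose f (i : 'I_n) := nth i r i.
have fi : injective f.
  move=> i j; rewrite /f (set_nth_default j) ?sr// => /eqP.
  by rewrite nth_uniq ?sr// => /eqP/val_inj.
exists (perm fi) => k.
have le_tot : total le_y by move=> i j; exact: le_total.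
have le_tr : transitive le_y by move=> i j l; exact: le_trans.
have so : sorted le_y r by exact: sort_sorted.
have le_2pi l : (l <= n)%N -> node (perm fi) y l <= 2 * pi.
  case: l => [|l] ln; first by rewrite /node /= ltW// twopi_gt0.
  by rewrite (node_ordS _ _ (Ordinal ln)); have /andP[_ /ltW] := yT (perm fi (Ordinal ln)).
rewrite leq_eqVlt => /orP[/eqP->|kn]; first by rewrite node_last le_2pi.
case: k kn => [|k] kn.
  by rewrite (node_ordS _ _ (Ordinal kn)); have /andP[] := yT (perm fi (Ordinal kn)).
rewrite (node_ordS _ _ (Ordinal kn)) (node_ordS _ _ (Ordinal (ltnW kn))) !permE /f.
have := @sorted_leq_nth _ _ le_tr (fun i => lexx (y i)) (Ordinal kn) r so k k.+1.
rewrite !inE sr => /(_ (ltnW kn) kn (leqnSn k)).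
by rewrite /= (set_nth_default (Ordinal kn) (Ordinal (ltnW kn))) ?sr// ltnW.
Qed.

(** * Equioscillation and the sandwich property *)

Section Main.
Variables (R : realType) (n : nat) (K : 'I_n.+1 -> R -> \bar R).
Hypothesis sK : forall j, strictly_concave_kernel (K j).
Implicit Types (y w : 'I_n -> R) (t : R).

Let cK j : concave_kernel (K j). Proof. by case: (sK j). Qed.

(** Comparison of suprema, phrased with an attained value [t'] for [y]. *)
Definition minimizer w := forall y, exists t', forall t,
  (translate_sum K (pinned w) t <= translate_sum K (pinned y) t')%E.

(** Along an arc all kernels are strictly concave, so the midpoint of two distinct maximum points
    would have a larger value. *)
Lemma arc_max_unique s w (k : nat) z z' : closed_simplex s w -> (k <= n)%N ->
  (forall z j, is_max K (pinned w) z -> ~ on_lattice (z - pinned w j)) ->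
  arc s w k z -> arc s w k z' -> is_max K (pinned w) z -> is_max K (pinned w) z' ->
  z = z'.
Proof.
move=> ws kn nolat zk zk' zm zm'; apply/eqP; apply: contrapT => /negP zz'.
have range u : arc s w k u -> is_max K (pinned w) u -> forall j,
    0 < u - pinned w j + (arc_shift s k j)%:~R * (2 * pi) < 2 * pi.
  move=> uk um j; have /andP[r1 r2] := arc_range j ws kn uk.
  rewrite !lt_neqAle r1 r2 !andbT; apply/andP; split; apply/eqP => e.
    by apply: (nolat u j um); exists (- arc_shift s k j); rewrite rmorphN/=; lra.
  apply: (nolat u j um); exists (1 - arc_shift s k j).
  by rewrite intrD rmorphN/= mulrDl mul1r; lra.
have fin u : arc s w k u -> is_max K (pinned w) u -> forall j,
    K j (u - pinned w j) \is a fin_num.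
  by move=> uk um j; apply: (kernel_fin (cK j)); exact: nolat.
pose q := 2^-1 * z + (1 - 2^-1) * z'.
have qE j : q - pinned w j =
    2^-1 * (z - pinned w j) + (1 - 2^-1) * (z' - pinned w j) by rewrite /q; ring.
have st j : 2^-1 * kreal (K j) (z - pinned w j) +
    (1 - 2^-1) * kreal (K j) (z' - pinned w j) < kreal (K j) (q - pinned w j).
  rewrite qE; apply: (kreal_strict_shift (sK j) (range z zk zm j) (range z' zk' zm' j)).
    by rewrite (inj_eq (addIr _)).
  by lra.
have fq j : K j (q - pinned w j) \is a fin_num.
  have r1 := range z zk zm j; have r2 := range z' zk' zm' j.
  apply: (kernel_fin (cK j)); apply: (@off_lattice_itv _ _ (arc_shift s k j)).
  by rewrite /q; lra.
have E1 : translate_sum K (pinned w) z = translate_sum K (pinned w) z'.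
  by apply/eqP; rewrite eq_le zm zm'.
have := zm q; rewrite leNgt => /negP; apply.
have f1 := fin z zk zm; have f2 := fin z' zk' zm'.
rewrite !translate_sum_fin// in E1 *; case: E1 => E1.
rewrite lte_fin.
have -> : \sum_j kreal (K j) (z - pinned w j) =
    \sum_j (2^-1 * kreal (K j) (z - pinned w j) +
    (1 - 2^-1) * kreal (K j) (z' - pinned w j)).
  by rewrite big_split /= -!mulr_sumr -E1; lra.
by apply: ltr_sum => //; apply/hasP; exists ord0; rewrite ?mem_index_enum.
Qed.

(** If arc [c] had no maximum point, the [n] remaining arcs, listed by [lift c], would contain them
    all, against [few_max_not_minimal]. *)
Lemma minimizer_arc_max s w : (0 < n)%N -> minimizer w -> closed_simplex s w ->
  (forall z j, is_max K (pinned w) z -> ~ on_lattice (z - pinned w j)) ->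
  forall k : 'I_n.+1, exists2 z, arc s w k z & is_max K (pinned w) z.
Proof.
move=> n0 wmin ws nolat c; apply: contrapT => nc.
have [z0 _ z0m] := translate_sum_max sK (pinned w).
have [|k z z' zk zk' zm zm'|y yP] := @few_max_not_minimal _ _ _ sK w z0
    (fun k => arc s w (lift c k)) n0 z0m nolat.
- move=> z zI zm; have [k zk] := arc_cover s w zI.
  move: zk; case: (unliftP c k) => [l -> zl|->]; first by exists l.
  by move=> zc; exfalso; apply: nc; exists z.
- by apply: (@arc_max_unique s w (lift c k)) => //; rewrite -ltnS.
have [t' /(_ z0)] := wmin y; rewrite leNgt => /negP; apply; exact: yP.
Qed.

(* Each arc maximum is a concave function of the nodes: if all of them were
   larger at [x] than the minimal value, then the node system [u] obtained by
   moving [w] slightly away from [x] would have a smaller maximum. *)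
Lemma minimizer_sandwich s w x z : minimizer w -> is_max K (pinned w) z ->
  simplex s w -> simplex s x -> exists k : 'I_n.+1, forall t, arc s x k t ->
  (translate_sum K (pinned x) t <= translate_sum K (pinned w) z)%E.
Proof.
move=> wmin zm ws xs; apply: contrapT => nk.
have big (k : 'I_n.+1) : exists t, arc s x k t /\
    (translate_sum K (pinned w) z < translate_sum K (pinned x) t)%E.
  apply: contrapT => nt; apply: nk; exists k => t tk.
  by rewrite leNgt; apply/negP => h; apply: nt; exists t.
(* The bound on [e] keeps the nodes in order when [w] is extrapolated away from [x]. *)
have [e [e0 eP]] : exists e, 0 < e /\ forall k : 'I_n.+1,
    e < (node s w k.+1 - node s w k) / (node s x k.+1 - node s x k).
  near (0 : R)^'+ => e; exists e; split; first by near: e; exact: nbhs_right_gt.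
  near: e; apply: filter_forall => k; apply: nbhs_right_lt.
  by rewrite divr_gt0// subr_gt0; [apply: ws|apply: xs]; rewrite -ltnS.
pose u i := w i + e * (w i - x i).
(* The weight for which [w] is the combination of [u] and [x]. *)
pose p := (1 + e)^-1.
have e2 : 0 < 1 + e by lra.
have pI : 0 < p < 1 by rewrite /p invr_gt0 e2 invf_lt1//= ltrDl.
have e1 : 1 + e != 0 by rewrite gt_eqF.
have wE i : w i = p * u i + (1 - p) * x i by rewrite /u /p; field.
have nu k : (k <= n.+1)%N -> node s w k = p * node s u k + (1 - p) * node s x k.
  by move=> kn; exact: node_affine.
have us : closed_simplex s u.
  move=> k kn; have h1 := nu k (leqW kn); have h2 := nu k.+1 kn.
  have : e * (node s x k.+1 - node s x k) < node s w k.+1 - node s w k.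
    rewrite -ltr_pdivlMr; last by rewrite subr_gt0; exact: xs.
    exact: (eP (Ordinal (kn : (k < n.+1)%N))).
  have pe : 1 - p = p * e by rewrite /p; field.
  move=> dx; have dw : node s w k < node s w k.+1 by exact: ws.
  have [p0 p1] : 0 < p /\ 0 < 1 - p by lra.
  have : 0 < p * (node s u k.+1 - node s u k).
    have := mulr_gt0 p0 (_ : 0 < node s w k.+1 - node s w k -
      e * (node s x k.+1 - node s x k)); rewrite subr_gt0 dx => /(_ isT).
    have := mulr_gt0 p1 (_ : 0 < node s w k.+1 - node s w k).
    rewrite subr_gt0 dw => /(_ isT).
    by rewrite pe in h1 h2; lra.
  by rewrite pmulr_rgt0// subr_gt0 => /ltW.
suff H t : (translate_sum K (pinned u) t < translate_sum K (pinned w) z)%E.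
  by have [t' /(_ z)] := wmin u; rewrite leNgt => /negP; apply.
suff {t} H t : 0 <= t <= 2 * pi ->
    (translate_sum K (pinned u) t < translate_sum K (pinned w) z)%E.
  have [m /andP[m1 m2]] := mod_twopi t.
  by rewrite -(translate_sum_periodic sK (pinned u) t m) H// m1 ltW.
move=> tI; have [k tk] := arc_cover s u tI; have [r [rk rM]] := big k.
have kn : (k <= n)%N by rewrite -ltnS.
have zgt := translate_sum_max_gtNy sK zm.
rewrite ltNge; apply/negP => tge.
have ft := translate_sum_finP sK (lt_le_trans zgt tge).
have fr := translate_sum_finP sK (lt_trans zgt rM).
have fz := translate_sum_finP sK zgt.
(* If [u] reached the minimal value at [t], the combination of [(u, t)] and [(x, r)] would be
   [(w, q)], with a value above the maximum for [w]. *)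
pose q := p * t + (1 - p) * r.
have pE j : pinned w j = p * pinned u j + (1 - p) * pinned x j.
  by rewrite /pinned; case: unlift => [i|] /=; [exact: wE|ring].
have qE j : q - pinned w j = p * (t - pinned u j) + (1 - p) * (r - pinned x j).
  by rewrite pE /q; ring.
have conc j := kreal_concave_shift (sK j) (arc_range j us kn tk)
  (arc_range j (simplexW xs) kn rk) pI (ft j) (fr j).
have fq j : K j (q - pinned w j) \is a fin_num by rewrite qE; case: (conc j).
have := zm q.
rewrite !translate_sum_fin// in tge rM *.
rewrite lee_fin in tge; rewrite lte_fin in rM.
rewrite lee_fin leNgt => /negP; apply.
apply: (@lt_le_trans _ _ (p * \sum_j kreal (K j) (t - pinned u j) +
   (1 - p) * \sum_j kreal (K j) (r - pinned x j))); first by nra.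
rewrite !mulr_sumr -big_split /=; apply: ler_sum => j _.
by rewrite qE; case: (conc j).
Unshelve. all: by end_near. Qed.

Lemma supF_max y z : is_max K (pinned y) z ->
  supF K y = translate_sum K (pinned y) z.
Proof.
move=> zm; apply/eqP; rewrite eq_le; apply/andP; split.
  by apply: ge_ereal_sup => _ [t _ <-]; rewrite Fsum_pinned.
have [m mP] := mod_twopi z.
apply: ereal_sup_ubound; exists (z + m%:~R * (2 * pi)) => //.
by rewrite Fsum_pinned translate_sum_periodic.
Qed.

Lemma mbar_supF s y : simplex s y -> mbar K s y = supF K y.
Proof.
move=> ys; apply/eqP; rewrite eq_le; apply/andP; split.
  apply/bigmax_leP; split; first exact: leNye.
  move=> k _; apply: ge_ereal_sup => _ [t _ <-].
  have [z _ zm] := translate_sum_max sK (pinned y).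
  by rewrite (supF_max zm) Fsum_pinned.
apply: ge_ereal_sup => _ [t /andP[t0 t1] <-].
have [|k tk] := @arc_cover _ _ s y t; first by rewrite t0 ltW.
apply: le_trans (le_bigmax _ _ k).
by apply: ereal_sup_ubound; exists t.
Qed.

End Main.

Theorem theorem11p1 (R : realType) (n : nat) (K : 'I_n.+1 -> R -> \bar R) :
  (0 < n)%N ->
  (forall j, strictly_concave_kernel (K j)) ->
  ((forall j, cond_inf' (K j)) \/ (forall j, C1_0_2pi (K j))) ->
  exists w : 'I_n -> R,
    [/\ torus_n w,
        Mval K = supF K w &
        exists s : {perm 'I_n},
          [/\ simplex s w,
              equioscillation K s w,
              MS K s = Mval K,
              Mval K = mS K s &
              forall x y, simplex s x -> simplex s y ->
                (munder K s x <= Mval K)%E /\ (Mval K <= mbar K s y)%E]].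
Proof.
move=> n0 sK hyp.
have [w wT wmin] := minimizer_exists sK.
have nolat z j : is_max K (pinned w) z -> ~ on_lattice (z - pinned w j).
  by move=> zm; exact: (node_not_max sK hyp zm).
have [z zT zm] := translate_sum_max sK (pinned w).
have supw : supF K w = translate_sum K (pinned w) z by exact: supF_max.
have Mle y : (supF K w <= supF K y)%E.
  have [z' _ zm'] := translate_sum_max sK (pinned y).
  rewrite supw (supF_max sK zm').
  by have [t' /(_ z) h] := wmin y; apply: le_trans h (zm' t').
have Mw : Mval K = supF K w.
  apply/eqP; rewrite eq_le; apply/andP; split.
    by apply: ereal_inf_lbound; exists w.
  by apply: le_ereal_inf_tmp => _ [y _ <-].
exists w; split => //.
have [s ws] := sorting_perm wT.
have amax := minimizer_arc_max sK n0 wmin ws nolat.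
exists s.
(* If two consecutive nodes coincided, the maximum point on the arc between them would be a node. *)
have ss : simplex s w.
  move=> k kn; have [z' /= /andP[z1 z2] zm'] := amax (Ordinal (kn : (k < n.+1)%N)).
  apply: lt_le_trans z2; rewrite lt_neqAle z1 andbT; apply/eqP => kz.
  have := nolat z' _ zm'.
  case: k kn {z1} kz => [|k] kn kz; last first.
    move/(_ (lift ord0 (s (Ordinal kn)))); apply; exists 0.
    by rewrite pinned_lift -(node_ordS s w (Ordinal kn)) /= kz subrr mul0r.
  by move/(_ ord0); apply; exists 0; rewrite pinned0 -kz /node /= subrr mul0r.
have mkw k : mk K s w k = supF K w.
  apply/eqP; rewrite eq_le; apply/andP; split.
    by apply: ge_ereal_sup => _ [t _ <-]; rewrite Fsum_pinned supw.
  have [z' z'k zm'] := amax k.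
  rewrite (supF_max sK zm'); apply: ereal_sup_ubound; exists z' => //.
  by rewrite Fsum_pinned.
have under_le x : simplex s x -> (munder K s x <= Mval K)%E.
  move=> xs; have [k kP] := minimizer_sandwich sK wmin zm ss xs.
  apply: (@le_trans _ _ (mk K s x k)); first exact: bigmin_le_cond.
  by rewrite Mw supw; apply: ge_ereal_sup => _ [t tk <-]; rewrite Fsum_pinned kP.
have le_bar y : simplex s y -> (Mval K <= mbar K s y)%E.
  by move=> ys; rewrite (mbar_supF sK ys) Mw.
split => //.
- by move=> k l; rewrite !mkw.
- apply/eqP; rewrite eq_le; apply/andP; split.
    by apply: ereal_inf_lbound; exists w => //; rewrite (mbar_supF sK ss).
  by apply: le_ereal_inf_tmp => _ [y ys <-]; exact: le_bar.
(* By equioscillation the minimum over the arcs at [w] equals the minimal value, so [w] realises the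
   supremum. *)
- apply/eqP; rewrite eq_le; apply/andP; split.
    apply: le_ereal_sup_tmp; exists (munder K s w); first by exists w.
    by apply/bigmin_geP; split => [|k _]; rewrite ?leey// mkw Mw.
  by apply: ge_ereal_sup => _ [x xs <-]; exact: under_le.
- by move=> x y xs ys; split; [exact: under_le|exact: le_bar].
Qed.
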